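(* Let $\{x_i\}_{i=1}^3\subset S^1$, and set $p_0=\frac{\log 3}{\log 2}$. Then $\mathrm{FP}_{p_0,3}(\{x_i\}_{i=1}^3)\ge 5$, and equality holds if and only if $\{x_i\}_{i=1}^3$ is an orthonormal basis plus one repeated vector or an equiangular FUNTF. Consequently: (1) for $0<p<p_0$ and any $\{x_i\}_{i=1}^3\subset S^1$, we have $\mathrm{FP}_{p,3}(\{x_i\}_{i=1}^3)\ge 5$, and equality holds if and only if $\{x_i\}_{i=1}^3$ is an orthonormal basis plus one repeated vector; (2) for $p_0<p<\infty$ and any $\{x_i\}_{i=1}^3\subset S^1$, we have $\mathrm{FP}_{p,3}(\{x_i\}_{i=1}^3)\ge\frac{6}{2^p}+3$, and equality holds if and only if $\{x_i\}_{i=1}^3$ is an equiangular FUNTF.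
   Context: $S^1$ is the unit circle in $\mathbb{R}^2$. Collections $\{x_i\}_{i=1}^3$ are indexed families, so vectors may be repeated. For $0<p<\infty$ and unit vectors $x_1,x_2,x_3\in S^1$, the $p$-frame potential is $\mathrm{FP}_{p,3}(\{x_i\}_{i=1}^3)=\sum_{i,j=1}^3|\langle x_i,x_j\rangle|^p$. A finite unit norm tight frame (FUNTF) for $\mathbb{R}^d$ is a collection of unit vectors $\{x_i\}_{i=1}^N\subset\mathbb{R}^d$ such that $\sum_{i=1}^N|\langle x,x_i\rangle|^2=\frac{N}{d}\|x\|^2$ for all $x\in\mathbb{R}^d$ (here $d=2$, $N=3$). A collection of unit vectors is equiangular if there is a constant $C\ge 0$ with $|\langle x_i,x_j\rangle|=C$ for all $i\neq j$; an equiangular FUNTF is a FUNTF that is equiangular. ''An orthonormal basis plus one repeated vector'' means the two vectors of an orthonormal basis of $\mathbb{R}^2$ together with one of these two vectors repeated.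
   Formalization: In the equality cases, ''an orthonormal basis plus one repeated vector'' is taken up to replacing some x_i by -x_i: read literally the claim fails, since for an orthonormal basis e_1, e_2 the family e_1, e_2, -e_1 attains the value 5 with no vector repeated. *)

(* Defs.v *)
From mathcomp Require Export all_boot all_order all_algebra.
From mathcomp Require Export all_classical all_reals all_analysis.
Set Implicit Arguments.
Unset Strict Implicit.
Unset Printing Implicit Defensive.
Import Order.TTheory GRing.Theory Num.Theory.
Local Open Scope ring_scope.

Definition dotp (R : realType) (d : nat) (u v : 'rV[R]_d) : R :=
  \sum_k u 0 k * v 0 k.

(* The library's norm on ['rV[R]_d] is the sup norm, hence this definition. *)
Definition enorm (R : realType) (d : nat) (u : 'rV[R]_d) : R :=
  Num.sqrt (dotp u u).

Definition unit_vectors (R : realType) (d N : nat) (x : 'I_N -> 'rV[R]_d) : Prop :=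
  forall i, enorm (x i) = 1.

(* [powR] satisfies [0 `^ p = 0] for [p != 0], so that orthogonal pairs
   contribute nothing to the sum. *)
Definition frame_potential (R : realType) (p : R) (d N : nat)
    (x : 'I_N -> 'rV[R]_d) : R :=
  \sum_i \sum_j `|dotp (x i) (x j)| `^ p.

Definition FUNTF (R : realType) (d N : nat) (x : 'I_N -> 'rV[R]_d) : Prop :=
  unit_vectors x /\
  forall y : 'rV[R]_d,
    \sum_i `|dotp y (x i)| ^+ 2 = N%:R / d%:R * enorm y ^+ 2.

Definition equiangular (R : realType) (d N : nat) (x : 'I_N -> 'rV[R]_d) : Prop :=
  unit_vectors x /\
  exists2 C : R, 0 <= C & forall i j, i != j -> `|dotp (x i) (x j)| = C.

Definition equiangular_FUNTF (R : realType) (d N : nat)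
    (x : 'I_N -> 'rV[R]_d) : Prop :=
  FUNTF x /\ equiangular x.

Definition orthonormal_basis (R : realType) (d : nat)
    (e : 'I_d -> 'rV[R]_d) : Prop :=
  basis_of {: 'rV[R]_d} (codom e) /\
  forall i j, dotp (e i) (e j) = (i == j)%:R.

(* [perm_eq] compares the families as multisets: the vectors may be listed in
   any order. *)
Definition onb_plus_repeated (R : realType) (d : nat)
    (x : 'I_d.+1 -> 'rV[R]_d) : Prop :=
  exists (e : 'I_d -> 'rV[R]_d) (r : 'I_d),
    orthonormal_basis e /\ perm_eq (codom x) (e r :: codom e).

(* Every frame potential is unchanged when some of the vectors are replaced by
   their opposites. For instance the family [e_1; e_2; - e_1], with [e_1; e_2]
   an orthonormal basis, attains the same value as [e_1; e_2; e_1], although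
   none of its vectors is literally repeated: as usual for frame potentials,
   minimizers are described up to signs. *)
Definition up_to_sign (R : realType) (d N : nat)
    (P : ('I_N -> 'rV[R]_d) -> Prop) (x : 'I_N -> 'rV[R]_d) : Prop :=
  exists s : 'I_N -> bool, P (fun i => (-1) ^+ s i *: x i).

Definition p0 (R : realType) : R := ln 3 / ln 2.

(* Main.v *)
Require Import Defs.
From mathcomp Require Import ring lra.
Import Order.TTheory GRing.Theory Num.Theory.
Import numFieldNormedType.Exports.
Local Open Scope ring_scope.
Set Implicit Arguments.
Unset Strict Implicit.
Unset Printing Implicit Defensive.

(** Write a, b, c for the numbers |<x_i, x_j>|, i < j, so that the potential is
    3 + 2 (a^p + b^p + c^p).  Three vectors of the plane are linearly dependent,
    hence their Gram determinant vanishes: the signed inner products satisfy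
    u^2 + v^2 + w^2 = 1 + 2 u v w ([gram_plane]).

    Everything follows from the critical exponent p0, the one with 2^p0 = 3, for
    which the claim is a^p0 + b^p0 + c^p0 >= 1 ([sum_powR_p0]):
    - below p0, t^p >= t^p0 on [0, 1], with equality only at 0 and 1
      ([powR_le_exponent]), which keeps the bound and discards the equiangular
      minimizer;
    - above p0, Bernoulli's inequality for the exponent p / p0 > 1 at the point
      3 t^p0, with equality only when t = 1/2, gives the bound 3 / 2^p
      ([sum_powR_gt_p0]) and discards the orthonormal one.

    At p0 there are two cases.  If u v w >= 0 the Gram identity gives
    a^2 + b^2 + c^2 >= 1, and p0 < 2 is enough.  If u v w < 0 then
    a^2 + b^2 + c^2 + 2 a b c = 1, that is a, b, c are the cosines of the angles
    of an acute triangle.  Both (1/2, 1/2, 1/2) and the degenerate triangle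
    (1, 0, 0) give equality, so the power is replaced by a polynomial agreeing
    with it at 0, 1/2 and 1: t^p0 >= t^2 q(t), where q is the quadratic
    interpolating t^(p0 - 2) doubly at 1/2 and simply at 1
    ([hermite_le_powR_p0]).  Equality holds only at the three nodes.  It remains
    to prove 1 <= a^2 q(a) + b^2 q(b) + c^2 q(c), a polynomial inequality about
    acute triangles ([acute_triangle_hermite]).  The quadratics with the values
    of q at 1/2 and 1 form a one-parameter family, and the inequality holds on a
    rational interval of parameters, so that two rational bounds on p0 suffice.

    Finally the scalar equality cases are turned into geometry: inner products
    0, 0, 1 in absolute value mean an orthonormal basis with one vector repeated
    up to sign ([onb_plus_repeated_of_pair]), and three values 1/2 mean an
    equiangular tight frame, because the frame operator then has trace 3 and
    squared Hilbert-Schmidt norm 9/2, hence is 3/2 times the identity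
    ([equiangular_FUNTF_half]). *)

(** * A polynomial inequality for acute triangles *)

(** The quadratics with value 4/3 at 1/2 and 1 at 1.  The slope at 1/2 is
    - 2 (1 + k) / 3, which for k = 4 r - 1 and 2^r = 4/3 is the slope of
    t^(- r) there. *)
Definition hermite {R : realFieldType} (k t : R) : R :=
  1 + 2/3 * (1 - t) * (1 + k * (1 - 2 * t)).

Lemma isosceles_factor_ge0 {R : realFieldType} (k u : R) :
  0 <= k <= 3/4 -> 0 <= u <= 1/2 ->
  0 <= 1 + 2 * u + 2 * u^+2 - 2 * k * u * (3 + 2 * u - 4 * u^+2 - 4 * u^+3).
Proof.
move=> /andP[k0 k1] /andP[u0 u1].
have h : 0 <= 1 - 5/2 * u - u^+2 + 6 * u^+3.
  by have := sqr_ge0 (u - 2/5); nra.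
have h2 : 0 <= u * (3 + 2 * u - 4 * u^+2 - 4 * u^+3) by nra.
have u4 : 0 <= u^+4 by apply: exprn_ge0.
nra.
Qed.

(** Up to the factor 2/3, the quotient by 1 - v of the difference between the
    values at v and at v = 1 (the isosceles triangle) of the sum bounded in
    [half_angle_hermite]. *)
Definition half_angle_cofactor {R : realFieldType} (k u v : R) : R :=
  5 * (1 - 2 * u^+2) * (1 + v) - (6 * u - 8 * u^+3) * (1 + v + v^+2)
  + 6 * u * (1 - u^+2)
  - k * (4 * (1 - 8 * u^+2 + 8 * u^+4) * (1 + v + v^+2 + v^+3)
         + 3 * (6 * u - 8 * u^+3) * (1 + v + v^+2)
         + (- 10 + 44 * u^+2 - 32 * u^+4) * (1 + v)
         - 18 * u * (1 - u^+2)).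

Lemma half_angle_cofactor0_ge0 {R : realFieldType} (u v : R) :
  0 <= u <= 1/2 -> 3/4 <= v <= 1 -> 0 <= half_angle_cofactor 0 u v.
Proof.
move=> /andP[u0 u1] /andP[v0 v1]; rewrite /half_angle_cofactor.
have h : 0 <= 6 * u - 8 * u^+3 by nra.
(* v^2 <= v leaves an expression affine in v *)
have h1 : (6 * u - 8 * u^+3) * (1 + v + v^+2)
    <= (6 * u - 8 * u^+3) * (1 + 2 * v).
  by apply: ler_wpM2l => //; nra.
have h2 : 0 <= 10 - 12 * u - 20 * u^+2 + 18 * u^+3 by nra.
have h3 : 0 <= 5 * (1 - 2 * u^+2) * (1 + v) - (6 * u - 8 * u^+3) * (1 + 2 * v)
    + 6 * u * (1 - u^+2) by nra.
lra.
Qed.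

Lemma half_angle_cofactor34_ge0 {R : realFieldType} (u v : R) :
  0 <= u <= 1/2 -> 3/4 <= v <= 1 -> 0 <= half_angle_cofactor (3/4) u v.
Proof.
move=> /andP[u0 u1] /andP[v0 v1].
(* In the small variable 1 - v the two lowest coefficients dominate. *)
set x := 1 - v.
have -> : half_angle_cofactor (3/4) u v =
   (13 - 39 * u + 10 * u^+2 + 117/2 * u^+3 - 48 * u^+4)
   + x * ((11/2 + 117/2 * u - 101 * u^+2 - 78 * u^+3 + 120 * u^+4)
   + x * ((- 12 - 39/2 * u + 96 * u^+2 + 26 * u^+3 - 96 * u^+4)
   + x * (3 - 24 * u^+2 + 24 * u^+4))).
  by rewrite /half_angle_cofactor /x; field.
have x0 : 0 <= x by rewrite /x; lra.
have x1 : x <= 1/4 by rewrite /x; lra.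
have u3 : 0 <= u^+3 by apply: exprn_ge0.
have u4 : 0 <= u^+4 by apply: exprn_ge0.
have c0 : 0 <= 13 - 39 * u + 10 * u^+2 + 117/2 * u^+3 - 48 * u^+4.
  have : 0 <= 13 - 39 * u + 10 * u^+2 + 69/2 * u^+3.
    by have := sqr_ge0 (u - 1/2); nra.
  have : 0 <= u^+3 * (1/2 - u) by rewrite mulr_ge0 //; lra.
  rewrite (exprS _ 3); lra.
have c1 : 5 <= 11/2 + 117/2 * u - 101 * u^+2 - 78 * u^+3 + 120 * u^+4.
  have -> : 11/2 + 117/2 * u - 101 * u^+2 - 78 * u^+3 + 120 * u^+4
      = 11/2 + u * ((117/2 - 101 * u - 78 * u^+2) + 120 * u^+3) by ring.
  suff : 0 <= u * ((117/2 - 101 * u - 78 * u^+2) + 120 * u^+3) by lra.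
  rewrite mulr_ge0 //.
  (* the tangent of 4 u^3 at 1/2 *)
  have : 0 <= (2 * u - 1)^+2 * (u + 1) by rewrite mulr_ge0 ?sqr_ge0 ?addr_ge0.
  nra.
have c2 : - 14 <= - 12 - 39/2 * u + 96 * u^+2 + 26 * u^+3 - 96 * u^+4.
  have : - 14 <= - 12 - 39/2 * u + 72 * u^+2.
    by have := sqr_ge0 (u - 1/7); nra.
  have : 0 <= u^+2 * ((1/2 - u) * (1/2 + u)).
    by rewrite mulr_ge0 ?exprn_ge0 ?mulr_ge0 //; lra.
  nra.
have c3 : - 3 <= 3 - 24 * u^+2 + 24 * u^+4 by nra.
nra.
Qed.

Lemma half_angle_cofactor_ge0 {R : realFieldType} (k u v : R) :
  0 <= k <= 3/4 -> 0 <= u <= 1/2 -> 3/4 <= v <= 1 ->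
  0 <= half_angle_cofactor k u v.
Proof.
move=> /andP[k0 k1] hu hv.
have h0 := half_angle_cofactor0_ge0 hu hv.
have h1 := half_angle_cofactor34_ge0 hu hv.
(* the cofactor is affine in k *)
have -> : half_angle_cofactor k u v = (1 - 4/3 * k) * half_angle_cofactor 0 u v
    + (4/3 * k) * half_angle_cofactor (3/4) u v.
  by rewrite /half_angle_cofactor; field.
by rewrite addr_ge0 // mulr_ge0 //; lra.
Qed.

(** For a triangle with angles A, B, C and cosines a, b, c, the half-angle
    parameters u = sin (A / 2) and v = cos ((B - C) / 2) make a and the
    elementary symmetric functions of b, c polynomial.  The excess over 1 is its
    value at the isosceles triangle v = 1, which has the double roots u = 0
    (degenerate) and u = 1/2 (equilateral), plus a nonnegative multiple of
    1 - v. *)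
Lemma half_angle_hermite {R : realFieldType} (k u v a b c : R) :
  0 <= k <= 3/4 -> 0 <= u <= 1/2 -> 3/4 <= v <= 1 ->
  a = 1 - 2 * u^+2 -> b + c = 2 * u * v -> b * c = u^+2 + v^+2 - 1 ->
  1 <= a^+2 * hermite k a + b^+2 * hermite k b + c^+2 * hermite k c.
Proof.
move=> hk hu hv ha hs hw; rewrite -subr_ge0.
set s := b + c in hs; set w := b * c in hw.
have -> : a^+2 * hermite k a + b^+2 * hermite k b + c^+2 * hermite k c - 1 =
    (a^+2 + s^+2 - 2 * w - 1)
    + 2/3 * ((1 + k) * (a^+2 + s^+2 - 2 * w)
      - (1 + 3 * k) * (a^+3 + s^+3 - 3 * s * w)
      + 2 * k * (a^+4 + (s^+2 - 2 * w)^+2 - 2 * w^+2)).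
  by rewrite /hermite /s /w; field.
rewrite ha hs hw.
set e := (X in 0 <= X).
have -> : e = 2/3 * (u^+2 * (1 - 2 * u)^+2
      * (1 + 2 * u + 2 * u^+2 - 2 * k * u * (3 + 2 * u - 4 * u^+2 - 4 * u^+3))
    + (1 - v) * half_angle_cofactor k u v).
  by rewrite /e /half_angle_cofactor; field.
have h1 := isosceles_factor_ge0 hk hu.
have h2 := half_angle_cofactor_ge0 hk hu hv.
have v1 : 0 <= 1 - v by lra.
by apply: mulr_ge0 => //; rewrite addr_ge0 // mulr_ge0 // mulr_ge0 // sqr_ge0.
Qed.

Lemma acute_triangle_hermite_max {R : rcfType} (k a b c : R) :
  0 <= k <= 3/4 -> 1/2 <= a <= 1 -> 0 <= b -> 0 <= c ->
  a^+2 + b^+2 + c^+2 + 2 * a * b * c = 1 ->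
  1 <= a^+2 * hermite k a + b^+2 * hermite k b + c^+2 * hermite k c.
Proof.
move=> hk /andP[a0 a1] b0 c0 H.
have bc0 : 0 <= b * c by rewrite mulr_ge0.
set u := Num.sqrt ((1 - a) / 2).
have u2 : u^+2 = (1 - a) / 2 by rewrite sqr_sqrtr //; lra.
have u0 : 0 <= u by apply: sqrtr_ge0.
have u1 : u <= 1/2 by nra.
set v := Num.sqrt (1 + b * c - u^+2).
have v2 : v^+2 = 1 + b * c - u^+2 by rewrite sqr_sqrtr // u2; lra.
have v0 : 0 <= v by apply: sqrtr_ge0.
have s2 : (b + c)^+2 = (2 * u * v)^+2.
  by rewrite !exprMn u2 v2 u2; lra.
have s : b + c = 2 * u * v.
  apply/eqP; rewrite -(eqrXn2 (n := 2)) ?s2 ?eqxx // ?addr_ge0 //.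
  by rewrite !mulr_ge0.
have v34 : 3/4 <= v by nra.
have v1 : v <= 1.
  (* AM-GM for b, c reads (1 - u^2) (1 - v^2) >= 0 *)
  have h : 4 * (b * c) <= (b + c)^+2 by have := sqr_ge0 (b - c); nra.
  rewrite s2 !exprMn in h.
  have h' : 0 <= (1 - u^+2) * (1 - v^+2) by nra.
  have h3 : 0 <= 1 - v^+2 by rewrite pmulr_rge0 // in h'; rewrite u2; lra.
  nra.
by apply: (@half_angle_hermite _ k u v) => //; rewrite ?u0 ?v34 //; lra.
Qed.

Lemma acute_triangle_hermite {R : rcfType} (k a b c : R) :
  0 <= k <= 3/4 -> 0 <= a <= 1 -> 0 <= b <= 1 -> 0 <= c <= 1 ->
  a^+2 + b^+2 + c^+2 + 2 * a * b * c = 1 ->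
  1 <= a^+2 * hermite k a + b^+2 * hermite k b + c^+2 * hermite k c.
Proof.
move=> hk /andP[a0 a1] /andP[b0 b1] /andP[c0 c1] H.
case: (leP (1/2) a) => ha.
  by apply: acute_triangle_hermite_max; rewrite // ha.
case: (leP (1/2) b) => hb.
  have := @acute_triangle_hermite_max R k b a c hk.
  by rewrite hb b1 a0 c0 => /(_ isT isT isT); lra.
case: (leP (1/2) c) => hc.
  have := @acute_triangle_hermite_max R k c b a hk.
  by rewrite hc c1 a0 b0 => /(_ isT isT isT); lra.
(* three cosines below 1/2, that is three angles above pi / 3 *)
exfalso.
have h1 : a^+2 < 1/4 by nra.
have h2 : b^+2 < 1/4 by nra.
have h3 : c^+2 < 1/4 by nra.
have h4 : a * b <= 1/4 by nra.
have h5 : a * b * c <= 1/8 by nra.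
lra.
Qed.

(** * Interpolation of a power at 1/2 and 1 *)

(** The derivative of t^r q(t).  It vanishes at the double node 1/2, and the
    remaining factor is affine, so it changes sign at most once more. *)
Definition hermite_powR' {R : realType} (r t : R) : R :=
  t `^ (r - 1) * (1 - 2 * t) *
    (r * (3 + 8 * r) - (8 * r - 2) * (r + 2) * t) / 3.

Lemma is_derive_hermite {R : realType} (r t : R) : 0 < r -> 0 < t ->
  is_derive t 1 (fun s => s `^ r * hermite (4 * r - 1) s) (hermite_powR' r t).
Proof.
move=> r0 t0.
have dp := @is_derive1_powR R r t t0.
have dq : is_derive t 1 (hermite (4 * r - 1))
    ((4 - 24 * r + 2 * (16 * r - 4) * t) / 3).
  pose P : {poly R} :=
    3^-1 *: ((3 + 8 * r)%:P + (4 - 24 * r) *: 'X + (16 * r - 4) *: 'X^2).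
  have -> : hermite (4 * r - 1) = horner P.
    by apply/funext => s; rewrite /hermite /P !hornerE /=; field.
  have -> : (4 - 24 * r + 2 * (16 * r - 4) * t) / 3 = P^`().[t].
    by rewrite /P !poly.derivE !hornerE; ring.
  exact: is_derive_poly.
have -> : hermite_powR' r t
    = t `^ r *: ((4 - 24 * r + 2 * (16 * r - 4) * t) / 3)
      + hermite (4 * r - 1) t *: (r * t `^ (r - 1)).
  rewrite -(mulr_powRB1 (ltW t0) r0) /hermite_powR' /hermite /GRing.scale /=.
  by field.
exact: is_deriveM.
Qed.

Lemma hermite_powR_MVT {R : realType} (r x y : R) : 0 < r -> 0 < x -> x < y ->
  exists2 c, x < c < y &
    y `^ r * hermite (4 * r - 1) y - x `^ r * hermite (4 * r - 1) x
      = hermite_powR' r c * (y - x).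
Proof.
move=> r0 x0 xy.
have [| |c cxy ->] := @MVT R (fun s => s `^ r * hermite (4 * r - 1) s)
  (hermite_powR' r) x y xy.
- move=> z; rewrite in_itv /= => /andP[xz _].
  by apply: is_derive_hermite => //; apply: lt_trans xz.
- apply: derivable_within_continuous => z; rewrite in_itv /= => /andP[xz _].
  apply: ex_derive; apply: is_derive_hermite => //; exact: lt_le_trans xz.
by exists c => //; rewrite in_itv /= in cxy.
Qed.

(** The function t^r q(t) takes the value 1 at 1/2 and at 1.  It increases up
    to 1/2, then decreases, then increases up to 1; every t is joined to one of
    the two nodes by an interval where the function is strictly monotone. *)
Lemma hermite_powR_lt1 {R : realType} (r t : R) :
  1/4 < r <= 1/2 -> 2 `^ r = 4/3 -> 0 < t < 1 -> t != 1/2 ->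
  t `^ r * hermite (4 * r - 1) t < 1.
Proof.
move=> /andP[r4 r2] E /andP[t0 t1] tn.
have r0 : 0 < r by lra.
have ghalf : (1/2) `^ r * hermite (4 * r - 1) (1/2) = 1.
  have -> : (1/2 : R) `^ r = 3/4.
    by rewrite mul1r -powR_inv1 // powRAC E powR_inv1; lra.
  by rewrite /hermite; field.
have gone : 1 `^ r * hermite (4 * r - 1) 1 = 1.
  by rewrite powR1 /hermite; ring.
pose l (c : R) := r * (3 + 8 * r) - (8 * r - 2) * (r + 2) * c.
have l_decr (x y : R) : x < y -> l y < l x.
  by move=> xy; rewrite /l ltrD2l ltrN2 ltr_pM2l // mulr_gt0; lra.
have sgn c : 0 < c -> forall s : R,
    0 < s * ((1 - 2 * c) * l c) -> 0 < s * hermite_powR' r c.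
  move=> c0 s hs; have p0 := powR_gt0 (r-1) c0.
  have -> : s * hermite_powR' r c
      = c `^ (r - 1) * (s * ((1 - 2 * c) * l c)) / 3.
    by rewrite /hermite_powR' /l; ring.
  by rewrite divr_gt0 // mulr_gt0.
case: (ltgtP t (1/2)) tn => // ht _.
  have [c /andP[tc c2] Ec] := hermite_powR_MVT r0 t0 ht.
  have := sgn c (lt_trans t0 tc) 1; rewrite !mul1r => h.
  rewrite -subr_gt0 -[X in 0 < X - _]ghalf Ec mulr_gt0 ?subr_gt0 //; apply: h.
  rewrite mulr_gt0 //; first lra.
  by rewrite /l; nra.
(* for t > 1/2 the node is chosen by the sign of the affine factor at t *)
case: (lerP 0 (l t)) => hl.
  have h2 : (0 : R) < 1/2 by lra.
  have [c /andP[tc c2] Ec] := hermite_powR_MVT r0 h2 ht.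
  have := sgn c (lt_trans h2 tc) (-1); rewrite !mulN1r => h.
  rewrite -subr_lt0 -[X in _ - X < 0]ghalf Ec -oppr_gt0 -mulNr.
  rewrite mulr_gt0 ?subr_gt0 //; apply: h.
  rewrite -mulNr mulr_gt0 //; first lra.
  by apply: le_lt_trans hl _; apply: l_decr.
have [c /andP[tc c2] Ec] := hermite_powR_MVT r0 t0 t1.
have := sgn c (lt_trans t0 tc) 1; rewrite !mul1r => h.
rewrite -subr_gt0 -[X in 0 < X - _]gone Ec mulr_gt0 ?subr_gt0 //; apply: h.
rewrite nmulr_lgt0; first by lra.
by apply: lt_trans hl; apply: l_decr.
Qed.

(** * Comparison of powers *)

Lemma powR_lt_exponent {R : realType} (t p q : R) :
  0 < t < 1 -> p < q -> t `^ q < t `^ p.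
Proof.
move=> /andP[t0 t1] pq; rewrite /powR gt_eqF // ltr_expR ltr_nM2r //.
by apply: ln_lt0; rewrite t0.
Qed.

Definition zero_or_one {R : realType} (t : R) := t = 0 \/ t = 1.

Lemma powR_le_exponent {R : realType} (t p q : R) :
  0 < p < q -> 0 <= t <= 1 ->
  t `^ q <= t `^ p /\ (t `^ p <= t `^ q -> zero_or_one t).
Proof.
move=> /andP[p0 pq] /andP[]; rewrite le_eqVlt => /predU1P[<-|t0].
  by rewrite !powR0 ?gt_eqF ?(lt_trans p0 pq) //; split; [|left].
rewrite le_eqVlt => /predU1P[->|t1]; first by rewrite !powR1; split; [|right].
have h : t `^ q < t `^ p by apply: powR_lt_exponent; rewrite ?t0.
by split; [exact: ltW | rewrite leNgt h].
Qed.

(** From x^(q - 1) = exp ((q - 1) ln x) > 1 + (q - 1) ln x and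
    ln x >= 1 - 1 / x, after multiplication by x. *)
Lemma bernoulli_powR {R : realType} (q x : R) :
  1 < q -> 0 <= x -> x != 1 -> 1 + q * (x - 1) < x `^ q.
Proof.
move=> q1 x0 x1; have q0 : 0 < q by lra.
have [->|xn0] := eqVneq x 0; first by rewrite powR0 ?gt_eqF //; lra.
have xp : 0 < x by rewrite lt_neqAle eq_sym xn0.
have lnx : 1 - x^-1 <= ln x.
  have : ln (1 + (x^-1 - 1)) <= x^-1 - 1.
    by apply: le_ln1Dx; rewrite ltrBrDr addNr invr_gt0.
  by rewrite addrC subrK lnV ?posrE //; lra.
rewrite -(mulr_powRB1 x0 q0) /powR gt_eqF //.
have e0 : (q - 1) * ln x != 0.
  by rewrite mulf_neq0 ?ln_eq0 // subr_eq0 gt_eqF.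
have := expR_gt1Dx e0; rewrite -(ltr_pM2l xp); apply: le_lt_trans.
have : x * ((q - 1) * (1 - x^-1)) <= x * ((q - 1) * ln x).
  by rewrite ler_pM2l // ler_pM2l // subr_gt0.
have -> : x * ((q - 1) * (1 - x^-1)) = (q - 1) * (x - 1) by field.
by lra.
Qed.

(** * The critical exponent *)

Lemma powR2_p0 {R : realType} : (2 : R) `^ p0 R = 3.
Proof.
have l2 : 0 < ln 2 :> R by rewrite ln_gt0 //; lra.
by rewrite /powR gt_eqF // /p0 divfK ?gt_eqF // lnK // posrE.
Qed.

(** Because 2^11 < 3^7 and 3^4 < 2^7. *)
Lemma p0_bounds {R : realType} : 11/7 < p0 R < 7/4.
Proof.
have l2 : 0 < ln 2 :> R by rewrite ln_gt0 //; lra.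
rewrite /p0 ltr_pdivlMr // ltr_pdivrMr //.
have h1 : ln (2 ^+ 11) < ln (3 ^+ 7) :> R.
  by rewrite ltr_ln ?posrE ?exprn_gt0 // -!natrX ltr_nat.
have h2 : ln (3 ^+ 4) < ln (2 ^+ 7) :> R.
  by rewrite ltr_ln ?posrE ?exprn_gt0 // -!natrX ltr_nat.
rewrite !lnXn // -!(mulr_natl (ln _)) in h1 h2.
apply/andP; split; lra.
Qed.

Lemma powR_p0_half {R : realType} : (1/2 : R) `^ p0 R = 1/3.
Proof. by rewrite !mul1r -powR_inv1 // powRAC powR2_p0 powR_inv1. Qed.

Lemma hermite_lt_powR_p0 {R : realType} (t : R) :
  0 < t < 1 -> t != 1/2 -> t ^+ 2 * hermite (7 - 4 * p0 R) t < t `^ p0 R.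
Proof.
move=> ht tn; have /andP[l u] := @p0_bounds R.
have t0 : 0 < t by case/andP: ht.
have E : (2 : R) `^ (2 - p0 R) = 4/3.
  by rewrite powRB ?pnatr_eq0 ?implybT // powR2_p0 (powR_mulrn 2) // -natrX.
have := hermite_powR_lt1 _ E ht tn.
have -> : 4 * (2 - p0 R) - 1 = 7 - 4 * p0 R by ring.
have -> : 1 / 4 < 2 - p0 R <= 1/2 by apply/andP; split; lra.
move=> /(_ isT); rewrite powRB ?(gt_eqF t0) ?implybT // (powR_mulrn 2) ?ltW //.
by rewrite mulrAC ltr_pdivrMr ?powR_gt0 // mul1r.
Qed.

Lemma hermite_le_powR_p0 {R : realType} (t : R) :
  0 <= t <= 1 -> t ^+ 2 * hermite (7 - 4 * p0 R) t <= t `^ p0 R.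
Proof.
move=> /andP[]; rewrite le_eqVlt => /predU1P[<-|t0].
  by rewrite expr0n mul0r powR_ge0.
rewrite le_eqVlt => /predU1P[->|t1].
  by rewrite powR1 /hermite expr1n !mulr1 mul1r; lra.
have [->|tn] := eqVneq t (1/2).
  by rewrite powR_p0_half /hermite; lra.
by apply/ltW/hermite_lt_powR_p0; rewrite // t0.
Qed.

(** * Sums of three powers *)

(** The sum of the minorants is already at least 1, so equality forces equality
    in each comparison: a, b, c are then nonzero nodes, 1/2 or 1. *)
Lemma acute_sum_powR_p0 {R : realType} (a b c : R) :
  0 < a <= 1 -> 0 < b <= 1 -> 0 < c <= 1 ->
  a^+2 + b^+2 + c^+2 + 2 * a * b * c = 1 ->
  1 <= a `^ p0 R + b `^ p0 R + c `^ p0 R /\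
  (a `^ p0 R + b `^ p0 R + c `^ p0 R = 1 -> [/\ a = 1/2, b = 1/2 & c = 1/2]).
Proof.
move=> /andP[a0 a1] /andP[b0 b1] /andP[c0 c1] H.
have /andP[l u] := @p0_bounds R.
have hA := @hermite_le_powR_p0 R a; have hB := @hermite_le_powR_p0 R b.
have hC := @hermite_le_powR_p0 R c.
rewrite (ltW a0) a1 in hA; rewrite (ltW b0) b1 in hB; rewrite (ltW c0) c1 in hC.
move/(_ isT): hA => hA; move/(_ isT): hB => hB; move/(_ isT): hC => hC.
have S : 1 <= a^+2 * hermite (7 - 4 * p0 R) a
    + b^+2 * hermite (7 - 4 * p0 R) b + c^+2 * hermite (7 - 4 * p0 R) c.
  apply: acute_triangle_hermite; rewrite ?(ltW a0) ?(ltW b0) ?(ltW c0) //; lra.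
split; first by lra.
move=> E.
have eqc (t : R) : 0 < t -> t <= 1 ->
    t `^ p0 R <= t ^+ 2 * hermite (7 - 4 * p0 R) t -> t = 1/2 \/ t = 1.
  move=> t0; rewrite le_eqVlt => /predU1P[->|t1] h; first by right.
  left; apply/eqP; apply: contraLR h => tn; rewrite -ltNge.
  by apply: hermite_lt_powR_p0; rewrite ?t0.
have [|aE|aE] := eqc a a0 a1; first lra.
all: have [|bE|bE] := eqc b b0 b1; first lra.
all: have [|cE|cE] := eqc c c0 c1; first lra.
(* of the eight combinations the constraint leaves only the equilateral one *)
all: move: H; rewrite aE bE cE => H; try (split => //).
all: exfalso; lra.
Qed.

Lemma sum_powR_of_sum_sqr_ge1 {R : realType} (p a b c : R) : 0 < p < 2 ->
  0 <= a <= 1 -> 0 <= b <= 1 -> 0 <= c <= 1 ->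
  1 <= a^+2 + b^+2 + c^+2 ->
  1 <= a `^ p + b `^ p + c `^ p /\
  (a `^ p + b `^ p + c `^ p = 1 ->
   [/\ zero_or_one a, zero_or_one b & zero_or_one c]).
Proof.
move=> hp ha hb hc H.
have [a1 a2] := powR_le_exponent hp ha.
have [b1 b2] := powR_le_exponent hp hb.
have [c1 c2] := powR_le_exponent hp hc.
case/andP: ha => a0 _; case/andP: hb => b0 _; case/andP: hc => c0 _.
rewrite !powR_mulrn // in a1 a2 b1 b2 c1 c2.
by split=> [|E]; [lra | split; [apply: a2|apply: b2|apply: c2]; lra].
Qed.

Lemma sum_powR_p0 {R : realType} (u v w : R) :
  `|u| <= 1 -> `|v| <= 1 -> `|w| <= 1 ->
  u^+2 + v^+2 + w^+2 = 1 + 2 * u * v * w ->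
  1 <= `|u| `^ p0 R + `|v| `^ p0 R + `|w| `^ p0 R /\
  (`|u| `^ p0 R + `|v| `^ p0 R + `|w| `^ p0 R = 1 ->
    [/\ zero_or_one `|u|, zero_or_one `|v| & zero_or_one `|w|] \/
    [/\ `|u| = 1/2, `|v| = 1/2 & `|w| = 1/2]).
Proof.
move=> u1 v1 w1; rewrite -(real_normK (num_real u)) -(real_normK (num_real v)).
rewrite -(real_normK (num_real w)) => H.
have /andP[l p2] := @p0_bounds R.
case: (lerP 0 (u * v * w)) => s.
  have [| | | | |h1 h2] := @sum_powR_of_sum_sqr_ge1 R (p0 R) `|u| `|v| `|w|;
    rewrite ?normr_ge0 //.
  - by apply/andP; split; lra.
  - by lra.
  by split => // /h2; left.
have : u * v * w != 0 by rewrite lt_eqF.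
rewrite !mulf_eq0 !negb_or -!normr_gt0 => /andP[/andP[u0 v0] w0].
have [| | | |h1 h2] := @acute_sum_powR_p0 R `|u| `|v| `|w|;
  rewrite ?u0 ?v0 ?w0 //.
  by rewrite -!mulrA -!normrM ltr0_norm mulrA //; lra.
by split => // /h2; right.
Qed.

Lemma sum_powR_lt_p0 {R : realType} (p u v w : R) : 0 < p < p0 R ->
  `|u| <= 1 -> `|v| <= 1 -> `|w| <= 1 ->
  u^+2 + v^+2 + w^+2 = 1 + 2 * u * v * w ->
  1 <= `|u| `^ p + `|v| `^ p + `|w| `^ p /\
  (`|u| `^ p + `|v| `^ p + `|w| `^ p = 1 ->
    [/\ zero_or_one `|u|, zero_or_one `|v| & zero_or_one `|w|]).
Proof.
move=> hp u1 v1 w1 H; have [S _] := sum_powR_p0 u1 v1 w1 H.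
have cmp (t : R) (t1 : `|t| <= 1) := @powR_le_exponent R `|t| _ _ hp.
have [|a1 a2] := cmp u u1; first by rewrite normr_ge0.
have [|b1 b2] := cmp v v1; first by rewrite normr_ge0.
have [|c1 c2] := cmp w w1; first by rewrite normr_ge0.
by split=> [|E]; [lra | split; [apply: a2|apply: b2|apply: c2]; lra].
Qed.

(** The tangent at x = 1 of x^(p / p0), taken at x = 3 t^p0 = (2 t)^p0, bounds
    (2 t)^p below, and the three tangents add up to at least 3 by the bound at
    p0. *)
Lemma sum_powR_gt_p0 {R : realType} (p u v w : R) : p0 R < p ->
  `|u| <= 1 -> `|v| <= 1 -> `|w| <= 1 ->
  u^+2 + v^+2 + w^+2 = 1 + 2 * u * v * w ->
  3 / 2 `^ p <= `|u| `^ p + `|v| `^ p + `|w| `^ p /\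
  (`|u| `^ p + `|v| `^ p + `|w| `^ p = 3 / 2 `^ p ->
    [/\ `|u| = 1/2, `|v| = 1/2 & `|w| = 1/2]).
Proof.
move=> hp u1 v1 w1 H; have [S _] := sum_powR_p0 u1 v1 w1 H.
have /andP[l _] := @p0_bounds R.
set q := p / p0 R.
have p00 : 0 < p0 R by lra.
have q1 : 1 < q by rewrite /q ltr_pdivlMr // mul1r.
have q0 : 0 < q by lra.
set m := 2 `^ p; have m0 : 0 < m by apply: powR_gt0.
have E (t : R) : 0 <= t -> (2 * t) `^ p0 R = 3 * t `^ p0 R.
  by move=> t0; rewrite powRM // powR2_p0.
have E2 (t : R) : 0 <= t -> (3 * t `^ p0 R) `^ q = m * t `^ p.
  move=> t0; rewrite -E // -powRrM /q mulrCA divff ?gt_eqF // mulr1.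
  by rewrite powRM.
have cmp (t : R) : 1 + q * (3 * `|t| `^ p0 R - 1) <= m * `|t| `^ p /\
   (m * `|t| `^ p <= 1 + q * (3 * `|t| `^ p0 R - 1) -> `|t| = 1/2).
  rewrite -E2 //; have [X1|Xn] := eqVneq (3 * `|t| `^ p0 R) 1.
    rewrite X1 powR1; split; first by lra.
    move=> _; rewrite -E // in X1; move/eqP: X1; rewrite powR_eq1.
    rewrite (gt_eqF p00) ltNge mulr_ge0 //= !orbF => /eqP; lra.
  have h : 1 + q * (3 * `|t| `^ p0 R - 1) < (3 * `|t| `^ p0 R) `^ q.
    by apply: bernoulli_powR => //; rewrite mulr_ge0 // powR_ge0.
  by split; [exact: ltW | rewrite leNgt h].
have [a1 a2] := cmp u; have [b1 b2] := cmp v; have [c1 c2] := cmp w.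
have T : 3 <= 3 + q * (3 * (`|u| `^ p0 R + `|v| `^ p0 R + `|w| `^ p0 R - 1)).
  by rewrite lerDl mulr_ge0 ?(ltW q0) // mulr_ge0 // subr_ge0.
split; first by rewrite ler_pdivrMr //; lra.
move=> /(congr1 (fun z => m * z)); rewrite mulrCA divff ?gt_eqF // mulr1 => F.
by split; [apply: a2|apply: b2|apply: c2]; lra.
Qed.

(** * Inner products in the plane *)

Lemma dotpC {R : realType} d (u v : 'rV[R]_d) : dotp u v = dotp v u.
Proof. by apply: eq_bigr => k _; rewrite mulrC. Qed.

Lemma dotpZ {R : realType} d (a b : R) (u v : 'rV[R]_d) :
  dotp (a *: u) (b *: v) = a * b * dotp u v.
Proof.
by rewrite /dotp mulr_sumr; apply: eq_bigr => k _; rewrite !mxE; ring.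
Qed.

Lemma dotp_ge0 {R : realType} d (u : 'rV[R]_d) : 0 <= dotp u u.
Proof. by apply: sumr_ge0 => k _; rewrite -expr2 sqr_ge0. Qed.

Lemma dotp_eq0 {R : realType} d (u : 'rV[R]_d) : dotp u u = 0 -> u = 0.
Proof.
move/eqP; rewrite psumr_eq0 => [|k _]; last by rewrite -expr2 sqr_ge0.
move/allP => h; apply/rowP => k; rewrite mxE; apply/eqP.
by have := h k; rewrite mem_index_enum mulf_eq0 orbb => /(_ isT).
Qed.

Lemma enorm_sqr {R : realType} d (u : 'rV[R]_d) : enorm u ^+ 2 = dotp u u.
Proof. by rewrite sqr_sqrtr // dotp_ge0. Qed.

Lemma enorm1 {R : realType} d (u : 'rV[R]_d) : enorm u = 1 <-> dotp u u = 1.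
Proof.
by split=> h; [rewrite -enorm_sqr h expr1n | rewrite /enorm h sqrtr1].
Qed.

Lemma dotp1_eq {R : realType} d (u v : 'rV[R]_d) :
  dotp u u = 1 -> dotp v v = 1 -> dotp u v = 1 -> u = v.
Proof.
move=> hu hv huv; apply/eqP; rewrite -subr_eq0; apply/eqP/dotp_eq0.
have -> : dotp (u - v) (u - v) = dotp u u + dotp v v - 2 * dotp u v.
  rewrite /dotp mulr_sumr -big_split -sumrB /=.
  by apply: eq_bigr => k _; rewrite !mxE; ring.
by rewrite hu hv huv; ring.
Qed.

Lemma dotp2E {R : realType} (u v : 'rV[R]_2) :
  dotp u v = u 0 0 * v 0 0 + u 0 1 * v 0 1.
Proof.
rewrite /dotp big_ord_recl big_ord1.
by congr (_ + u _ _ * v _ _); apply/val_inj.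
Qed.

(** The Gram determinant of three vectors of the plane vanishes. *)
Lemma gram_plane {R : realType} (x y z : 'rV[R]_2) :
  dotp x x = 1 -> dotp y y = 1 -> dotp z z = 1 ->
  dotp x y ^+ 2 + dotp x z ^+ 2 + dotp y z ^+ 2
    = 1 + 2 * dotp x y * dotp x z * dotp y z.
Proof.
move=> hx hy hz.
have : dotp x x * dotp y y * dotp z z + 2 * dotp x y * dotp x z * dotp y z
  = dotp z z * dotp x y ^+ 2 + dotp y y * dotp x z ^+ 2
    + dotp x x * dotp y z ^+ 2.
  by rewrite !dotp2E; ring.
by rewrite hx hy hz !mul1r => ->.
Qed.

Lemma cauchy_schwarz_plane {R : realType} (x y : 'rV[R]_2) :
  dotp x x = 1 -> dotp y y = 1 -> `|dotp x y| <= 1.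
Proof.
move=> hx hy; rewrite -(@expr_le1 R 2) // real_normK ?num_real // -subr_ge0.
have : dotp x x * dotp y y - dotp x y ^+ 2
    = (x 0 0 * y 0 1 - x 0 1 * y 0 0) ^+ 2 by rewrite !dotp2E; ring.
by rewrite hx hy mul1r => ->; rewrite sqr_ge0.
Qed.

(** * Minimizers of the frame potential *)

Lemma sum_ord3 {R : realType} (F : 'I_3 -> R) :
  \sum_i F i = F 0 + F 1 + F 2.
Proof.
rewrite !big_ord_recr /= big_ord0 add0r.
by congr (F _ + F _ + F _); apply/val_inj.
Qed.

Lemma forall_ord3 (P : 'I_3 -> Prop) : P 0 -> P 1 -> P 2 -> forall i, P i.
Proof.
move=> h0 h1 h2 [[|[|[|//]]] hi].
- by have -> : Ordinal hi = 0 by apply/val_inj.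
- by have -> : Ordinal hi = 1 by apply/val_inj.
- by have -> : Ordinal hi = 2 by apply/val_inj.
Qed.

Lemma frame_potential3 {R : realType} (p : R) d (x : 'I_3 -> 'rV[R]_d) :
  unit_vectors x ->
  frame_potential p x = 3 + 2 * (`|dotp (x 0) (x 1)| `^ p
    + `|dotp (x 0) (x 2)| `^ p + `|dotp (x 1) (x 2)| `^ p).
Proof.
move=> ux; have u1 i : dotp (x i) (x i) = 1 by apply/enorm1.
rewrite /frame_potential sum_ord3 !sum_ord3 !u1 normr1 powR1.
rewrite (dotpC (x 1) (x 0)) (dotpC (x 2) (x 0)) (dotpC (x 2) (x 1)).
by ring.
Qed.

Lemma orthonormal_basis_of {R : realType} d (e : 'I_d -> 'rV[R]_d) :
  (forall i j, dotp (e i) (e j) = (i == j)%:R) ->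
  basis_of {: 'rV[R]_d} (codom e).
Proof.
move=> he.
have -> : codom e = [tuple e i | i < d] by rewrite /= /codom /image_mem enumT.
rewrite basisEfree subvf size_tuple dimvf dim_matrix mul1r leqnn !andbT.
apply/freeP => k hk i.
have : dotp (\sum_(j < d) k j *: [tuple e i | i < d]`_j) (e i) = 0.
  by rewrite hk /dotp big1 // => j _; rewrite mxE mul0r.
rewrite /dotp.
under eq_bigr => l _.
  rewrite summxE mulr_suml; under eq_bigr => j _ do
    rewrite -tnth_nth tnth_mktuple mxE -mulrA.
  over.
rewrite exchange_big /=; under eq_bigr => j _ do rewrite -mulr_sumr.
rewrite (bigD1 i) //= [X in k i * X](he i i) eqxx mulr1 big1 ?addr0 //.
by move=> j ji; rewrite [X in k j * X](he j i) (negbTE ji) mulr0.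
Qed.

(** The potential is a double sum over the multiset of the vectors, hence it may
    be computed on any listing of them. *)
Lemma frame_potential_onb_plus_repeated {R : realType} (p : R) d
    (x : 'I_d.+1 -> 'rV[R]_d) : p != 0 ->
  onb_plus_repeated x -> frame_potential p x = d%:R + 3.
Proof.
move=> p0 [e [r [[_ he] hx]]].
pose G (s : seq 'rV[R]_d) (u : 'rV[R]_d) := \sum_(v <- s) `|dotp u v| `^ p.
have -> : frame_potential p x = \sum_(u <- codom x) G (codom x) u.
  rewrite /frame_potential big_image /=; apply: eq_bigr => i _.
  by rewrite /G big_image.
have GE u : G (codom x) u = G (e r :: codom e) u by apply: perm_big.
rewrite (perm_big _ hx) /=; under eq_bigr => u _ do rewrite GE.
have delta i j : `|dotp (e i) (e j)| `^ p = (i == j)%:R.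
  by rewrite he; case: eqP => _; rewrite ?normr1 ?powR1 // normr0 powR0.
have GeE i : G (e r :: codom e) (e i) = (i == r)%:R + 1.
  rewrite /G big_cons big_image /= delta (bigD1 i) //= delta eqxx.
  rewrite big1 ?addr0 //.
  by move=> j ji; rewrite delta eq_sym (negbTE ji).
rewrite big_cons big_image /= GeE eqxx.
under eq_bigr => i _ do rewrite GeE.
rewrite big_split /= sumr_const card_ord (bigD1 r) //= eqxx big1 ?addr0.
  by rewrite mulr1n; ring.
by move=> i /negbTE ->.
Qed.

Lemma frame_potential_sign {R : realType} (p : R) d N (x : 'I_N -> 'rV[R]_d)
    (s : 'I_N -> bool) :
  frame_potential p (fun i => (-1) ^+ s i *: x i) = frame_potential p x.
Proof.
apply: eq_bigr => i _; apply: eq_bigr => j _.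
by rewrite dotpZ !normrM !normr_sign !mul1r.
Qed.

(** Cauchy-Schwarz is an equality for x_i and x_j, so flipping x_j when their
    inner product is negative turns it into a copy of x_i. *)
Lemma onb_plus_repeated_of_pair {R : realType} (x : 'I_3 -> 'rV[R]_2)
    (i j k : 'I_3) : unit_vectors x -> perm_eq (enum 'I_3) [:: i; j; k] ->
  `|dotp (x i) (x j)| = 1 -> dotp (x i) (x k) = 0 ->
  up_to_sign (@onb_plus_repeated R 2) x.
Proof.
move=> ux hp hij hik; have u1 l : dotp (x l) (x l) = 1 by apply/enorm1.
have : uniq [:: i; j; k] by rewrite -(perm_uniq hp) enum_uniq.
rewrite /= !inE negb_or andbT => /andP[/andP[ij ik] jk].
exists (fun l => (l == j) && (dotp (x i) (x j) < 0)).
set y := fun l => _.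
have yi : y i = x i by rewrite /y (negbTE ij) /= expr0 scale1r.
have yk : y k = x k by rewrite /y eq_sym (negbTE jk) /= expr0 scale1r.
have yj : y j = x i.
  apply/esym/dotp1_eq => //; rewrite /y eqxx /=.
    by rewrite dotpZ u1 mulr1 -expr2 sqrr_sign.
  by rewrite -[x i]scale1r dotpZ mul1r scale1r -normrEsign.
pose e (m : 'I_2) := if m == 0 then x i else x k.
have codomE (f : 'I_2 -> 'rV[R]_2) : codom f = [:: f 0; f 1].
  rewrite /codom /image_mem enum_ordSl enum_ordSl /= enum_ord0 /=.
  by congr [:: f _; f _]; apply/val_inj.
exists e, 0; split.
  have he : forall a b, dotp (e a) (e b) = (a == b)%:R.
    move=> [[|[|//]] ?] [[|[|//]] ?]; rewrite /e !eqE /= ?u1 ?hik //.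
    by rewrite dotpC hik.
  by split; [exact: orthonormal_basis_of | exact: he].
rewrite codomE /=; have := perm_map y hp.
by rewrite /= yi yj yk.
Qed.

(** Testing tightness on x_0 gives 1 + 2 C^2 = 3/2.  Conversely let S be the
    frame operator, the sum of the x_i x_i^T, of trace 3.  The inner products
    give tr S^2 = 3 + 6/4 = (tr S)^2 / 2, and a symmetric 2 x 2 matrix with
    tr S^2 = (tr S)^2 / 2 is scalar. *)
Lemma equiangular_FUNTF_half {R : realType} (x : 'I_3 -> 'rV[R]_2) :
  unit_vectors x ->
  (equiangular_FUNTF x <->
   [/\ `|dotp (x 0) (x 1)| = 1/2, `|dotp (x 0) (x 2)| = 1/2
     & `|dotp (x 1) (x 2)| = 1/2]).
Proof.
move=> ux; have u1 l : dotp (x l) (x l) = 1 by apply/enorm1.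
split=> [[[_ tight] [_ [C C0 hC]]]|[h01 h02 h12]].
  rewrite !hC //; have := tight (x 0).
  rewrite sum_ord3 u1 !hC // enorm_sqr u1 normr1 => E.
  by have -> : C = 1/2 by nra.
have sq (a : R) : `|a| = 1/2 -> a ^+ 2 = 1/4.
  by move=> h; rewrite -(real_normK (num_real a)) h; lra.
have {}sq01 := sq _ h01; have {}sq02 := sq _ h02; have {}sq12 := sq _ h12.
split; split => //; last first.
  exists (1/2); first by lra.
  by apply: forall_ord3; apply: forall_ord3 => //; rewrite dotpC.
move=> y; rewrite sum_ord3 enorm_sqr !real_normK ?num_real //.
have := u1 0; have := u1 1; have := u1 2.
move: sq01 sq02 sq12; rewrite !dotp2E.
set a0 := x 0 0 0; set b0 := x 0 0 1; set a1 := x 1 0 0; set b1 := x 1 0 1.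
set a2 := x 2 0 0; set b2 := x 2 0 1.
move=> e01 e02 e12 e2 e1 e0.
(* entries A, C, B of the frame operator *)
set A := a0^+2 + a1^+2 + a2^+2; set B := b0^+2 + b1^+2 + b2^+2.
set C := a0*b0 + a1*b1 + a2*b2.
have tr : A + B = 3.
  have -> : A + B = (a0*a0 + b0*b0) + (a1*a1 + b1*b1) + (a2*a2 + b2*b2).
    by rewrite /A /B; ring.
  by rewrite e0 e1 e2; ring.
have tr2 : A^+2 + B^+2 + 2*C^+2 = 9/2.
  have -> : A^+2 + B^+2 + 2*C^+2
    = (a0*a0 + b0*b0)^+2 + (a1*a1 + b1*b1)^+2 + (a2*a2 + b2*b2)^+2
      + 2*((a0*a1 + b0*b1)^+2 + (a0*a2 + b0*b2)^+2 + (a1*a2 + b1*b2)^+2).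
    by rewrite /A /B /C; ring.
  by rewrite e0 e1 e2 e01 e02 e12; lra.
have dev : (A - B)^+2 + (2*C)^+2 = 0.
  have -> : (A - B)^+2 + (2*C)^+2 = 2*(A^+2 + B^+2 + 2*C^+2) - (A+B)^+2 by ring.
  by rewrite tr tr2; lra.
move/eqP: dev; rewrite paddr_eq0 ?sqr_ge0 // !sqrf_eq0.
move=> /andP[/eqP AB /eqP C0].
have -> : (y 0 0 * a0 + y 0 1 * b0)^+2 + (y 0 0 * a1 + y 0 1 * b1)^+2
  + (y 0 0 * a2 + y 0 1 * b2)^+2
  = A * (y 0 0 * y 0 0) + B * (y 0 1 * y 0 1) + (2*C) * (y 0 0 * y 0 1).
  by rewrite /A /B /C; ring.
have -> : A = 3/2 by lra.
have -> : B = 3/2 by lra.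
by rewrite C0; ring.
Qed.

(** * The three ranges of the exponent *)

Lemma frame_potential_up_to_sign_onb {R : realType} (p : R)
    (x : 'I_3 -> 'rV[R]_2) : p != 0 ->
  up_to_sign (@onb_plus_repeated R 2) x -> frame_potential p x = 5.
Proof.
move=> p0 [s hs]; rewrite -(frame_potential_sign p x s).
by rewrite (frame_potential_onb_plus_repeated p0 hs); ring.
Qed.

Lemma frame_potential_equiangular_FUNTF {R : realType} (p : R)
    (x : 'I_3 -> 'rV[R]_2) : unit_vectors x ->
  equiangular_FUNTF x -> frame_potential p x = 6 / 2 `^ p + 3.
Proof.
move=> ux /(equiangular_FUNTF_half ux)[h0 h1 h2].
rewrite frame_potential3 // h0 h1 h2.
have -> : (1/2 : R) `^ p = (2 `^ p)^-1.
  by rewrite mul1r -powR_inv1 // powRAC powR_inv1 ?powR_ge0.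
by ring.
Qed.

Lemma up_to_sign_onb_of_zero_or_one {R : realType} (p : R)
    (x : 'I_3 -> 'rV[R]_2) : p != 0 -> unit_vectors x ->
  `|dotp (x 0) (x 1)| `^ p + `|dotp (x 0) (x 2)| `^ p
    + `|dotp (x 1) (x 2)| `^ p = 1 ->
  [/\ zero_or_one `|dotp (x 0) (x 1)|, zero_or_one `|dotp (x 0) (x 2)|
    & zero_or_one `|dotp (x 1) (x 2)|] ->
  up_to_sign (@onb_plus_repeated R 2) x.
Proof.
move=> p0 ux + [[h01|h01] [h02|h02] [h12|h12]];
  rewrite ?h01 ?h02 ?h12 ?powR1 ?(powR0 p0) => S; try by exfalso; lra.
- apply: (@onb_plus_repeated_of_pair _ _ 1 2 0) => //.
    by apply: (perm_map_inj val_inj); rewrite val_enum_ord.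
  by rewrite dotpC; apply/normr0_eq0.
- apply: (@onb_plus_repeated_of_pair _ _ 0 2 1) => //.
    by apply: (perm_map_inj val_inj); rewrite val_enum_ord.
  by apply/normr0_eq0.
- apply: (@onb_plus_repeated_of_pair _ _ 0 1 2) => //.
    by apply: (perm_map_inj val_inj); rewrite val_enum_ord.
  by apply/normr0_eq0.
Qed.

Theorem corollary3p7 (R : realType) :
  (forall x : 'I_3 -> 'rV[R]_2, unit_vectors x ->
     5 <= frame_potential (p0 R) x /\
     (frame_potential (p0 R) x = 5 <->
        up_to_sign (@onb_plus_repeated R 2) x \/ equiangular_FUNTF x)) /\
  (forall p : R, 0 < p < p0 R ->
     forall x : 'I_3 -> 'rV[R]_2, unit_vectors x ->
       5 <= frame_potential p x /\
       (frame_potential p x = 5 <-> up_to_sign (@onb_plus_repeated R 2) x)) /\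
  (forall p : R, p0 R < p ->
     forall x : 'I_3 -> 'rV[R]_2, unit_vectors x ->
       6 / 2 `^ p + 3 <= frame_potential p x /\
       (frame_potential p x = 6 / 2 `^ p + 3 <-> equiangular_FUNTF x)).
Proof.
have /andP[l _] := @p0_bounds R.
have p00 : 0 < p0 R by lra.
have gram (x : 'I_3 -> 'rV[R]_2) : unit_vectors x ->
    [/\ `|dotp (x 0) (x 1)| <= 1, `|dotp (x 0) (x 2)| <= 1,
        `|dotp (x 1) (x 2)| <= 1
      & dotp (x 0) (x 1) ^+ 2 + dotp (x 0) (x 2) ^+ 2 + dotp (x 1) (x 2) ^+ 2
        = 1 + 2 * dotp (x 0) (x 1) * dotp (x 0) (x 2) * dotp (x 1) (x 2)].
  move=> ux; have u1 i : dotp (x i) (x i) = 1 by apply/enorm1.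
  by split; [exact: cauchy_schwarz_plane..|exact: gram_plane].
split; [|split].
- move=> x ux; have [h01 h02 h12 G] := gram x ux.
  have [S eqS] := sum_powR_p0 h01 h02 h12 G.
  have FE := frame_potential3 (p0 R) ux.
  have pn : p0 R != 0 by rewrite gt_eqF.
  split; first by lra.
  split=> [F|[|] H].
  + have S1 : `|dotp (x 0) (x 1)| `^ p0 R + `|dotp (x 0) (x 2)| `^ p0 R
        + `|dotp (x 1) (x 2)| `^ p0 R = 1 by lra.
    case: (eqS S1) => H; [left|right].
      exact: up_to_sign_onb_of_zero_or_one S1 H.
    exact/equiangular_FUNTF_half.
  + exact: frame_potential_up_to_sign_onb.
  + by rewrite frame_potential_equiangular_FUNTF // powR2_p0; lra.
- move=> p hp x ux; have [h01 h02 h12 G] := gram x ux.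
  have [S eqS] := sum_powR_lt_p0 hp h01 h02 h12 G.
  have FE := frame_potential3 p ux.
  have pn : p != 0 by case/andP: hp => hp _; rewrite gt_eqF.
  split; first by lra.
  split=> [F|]; last exact: frame_potential_up_to_sign_onb.
  have S1 : `|dotp (x 0) (x 1)| `^ p + `|dotp (x 0) (x 2)| `^ p
      + `|dotp (x 1) (x 2)| `^ p = 1 by lra.
  exact: up_to_sign_onb_of_zero_or_one S1 (eqS S1).
- move=> p hp x ux; have [h01 h02 h12 G] := gram x ux.
  have [S eqS] := sum_powR_gt_p0 hp h01 h02 h12 G.
  have FE := frame_potential3 p ux.
  have six : 6 / 2 `^ p = 2 * (3 / 2 `^ p) :> R by ring.
  split; first by lra.
  split=> [F|]; last exact: frame_potential_equiangular_FUNTF.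
  by apply/equiangular_FUNTF_half => //; apply: eqS; lra.
Qed.
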